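(* Let $k\ge 1$ be an integer. There exists $N=N(k)$ such that for every $n\ge N$ the following holds: if $G$ is a graph on $n$ vertices that contains no copy of the $k$-fan $F_k$, and $G$ has the maximum spectral radius among all $F_k$-free graphs on $n$ vertices, then $G\in \mathrm{Ex}(n,F_k)$, i.e. $G$ is $F_k$-free with exactly $\mathrm{ex}(n,F_k)$ edges.
   Context: All graphs are finite, simple and undirected. The spectral radius $\lambda_1(G)$ of a graph $G$ is the largest eigenvalue of its adjacency matrix. The $k$-fan $F_k$ is the graph on $2k+1$ vertices consisting of $k$ triangles sharing exactly one common vertex (and otherwise vertex-disjoint). $G$ contains a copy of $F_k$ if it has a (not necessarily induced) subgraph isomorphic to $F_k$. The Turán number $\mathrm{ex}(n,F_k)$ is the maximum number of edges of an $F_k$-free graph on $n$ vertices, and $\mathrm{Ex}(n,F_k)$ is the set of $F_k$-free graphs on $n$ vertices with exactly $\mathrm{ex}(n,F_k)$ edges. *)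

(* Defs.v *)
From HB Require Import structures.
From mathcomp Require Import all_boot all_order all_algebra.
From mathcomp Require Import complex polyrcf.
From mathcomp Require Import classical_sets reals.

Set Implicit Arguments.
Unset Strict Implicit.
Unset Printing Implicit Defensive.

Import Order.TTheory GRing.Theory Num.Theory.

Record sgraph (V : finType) := SGraph {
  adj_ffun : {ffun V * V -> bool};
  _ : [forall x, ~~ adj_ffun (x, x)] &&
      [forall x, forall y, adj_ffun (x, y) == adj_ffun (y, x)]
}.

HB.instance Definition _ (V : finType) := [isSub for @adj_ffun V].
HB.instance Definition _ (V : finType) := [Finite of sgraph V by <:].

Definition adj (V : finType) (G : sgraph V) : rel V :=
  fun x y => adj_ffun G (x, y).

Definition edges (V : finType) (G : sgraph V) : {set {set V}} :=
  [set [set p.1; p.2] | p : V * V & adj G p.1 p.2].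

Definition contains_copy (U V : finType) (H : sgraph U) (G : sgraph V) : bool :=
  [exists f : {ffun U -> V},
    injectiveb f && [forall x, forall y, adj H x y ==> adj G (f x) (f y)]].

Definition graph_free (U V : finType) (H : sgraph U) (G : sgraph V) : bool :=
  ~~ contains_copy H G.

(* [None] is the common vertex; the i-th triangle is
   [None], [Some (i, false)], [Some (i, true)]. *)
Definition fan_rel (k : nat) (p : option ('I_k * bool) * option ('I_k * bool)) :
    bool :=
  match p with
  | (Some (i, a), Some (j, b)) => (i == j) && (a != b)
  | (None, None) => false
  | _ => true
  end.

Fact fan_subproof (k : nat) (g := finfun (@fan_rel k)) :
  [forall x, ~~ g (x, x)] && [forall x, forall y, g (x, y) == g (y, x)].
Proof.
apply/andP; split; first by apply/forallP=> -[[i a]|]; rewrite ffunE //= !eqxx.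
apply/forallP=> -[[i a]|]; apply/forallP=> -[[j b]|]; rewrite !ffunE //=.
by rewrite (eq_sym i) (eq_sym a).
Qed.

Definition fan (k : nat) : sgraph (option ('I_k * bool)) :=
  SGraph (fan_subproof k).

Definition turan_number (n : nat) (U : finType) (H : sgraph U) : nat :=
  \max_(G : sgraph 'I_n | graph_free H G) #|edges G|.

Definition extremal_graphs (n : nat) (U : finType) (H : sgraph U) : {set sgraph 'I_n} :=
  [set G | graph_free H G & #|edges G| == turan_number n H].

Definition adjmx (R : nzRingType) (n : nat) (G : sgraph 'I_n) : 'M[R]_n :=
  (\matrix_(i, j) (adj G i j)%:R)%R.

(* The set is finite, and nonempty when 0 < n (the matrix is symmetric), so the
   supremum is the largest eigenvalue: see [spectral_radiusP]. *)
Definition spectral_radius (R : realType) (n : nat) (G : sgraph 'I_n) : R :=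
  sup [set a : R | eigenvalue (adjmx R G) a]%classic.

Local Open Scope ring_scope.

Lemma symmx_eigenvalue (R : rcfType) (n : nat) (A : 'M[R]_n) :
  (0 < n)%N -> A^T = A -> exists a, eigenvalue A a.
Proof.
case: n A => // n A _ AT.
pose f : {rmorphism R -> R[i]} := real_complex R.
pose B := map_mx f A.
have [l rl] : exists l, root (char_poly B) l.
  by apply/closed_rootP; rewrite size_char_poly.
have /eigenvalueP [v vB v0] : eigenvalue B l by rewrite eigenvalue_root_char.
pose w := map_mx Num.conj v.
have Bc : map_mx Num.conj B = B.
  by apply/matrixP=> i j; rewrite !mxE; apply/CrealP/complex_realP; eexists.
have wB : w *m B = Num.conj l *: w.
  by rewrite -{1}Bc -map_mxM vB map_mxZ.
have BT : B^T = B by rewrite map_trmx AT.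
have E : l *: (v *m w^T) = Num.conj l *: (v *m w^T).
  rewrite scalemxAl -vB -mulmxA -{1}BT -trmx_mul wB linearZ /=.
  by rewrite -scalemxAr.
have lr : l \is Num.real.
  apply/CrealP; apply/eqP; rewrite -subr_eq0; apply/eqP.
  have := congr1 (fun M : 'M_1 => M 0 0) E; rewrite !mxE => /eqP.
  rewrite -subr_eq0 -mulrBl mulf_eq0 => /orP[/eqP h|].
    by rewrite -opprB h oppr0.
  have ge0 (i : 'I_n.+1) : true -> 0 <= v 0 i * w^T i 0.
    by move=> _; rewrite !mxE mul_conjC_ge0.
  rewrite psumr_eq0 // => /allP z; case/eqP: v0.
  apply/rowP => i; rewrite !mxE; apply/eqP.
  by have := z i (mem_index_enum i); rewrite !mxE mul_conjC_eq0.
have [a la] := complex_realP _ lr.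
exists a; rewrite eigenvalue_root_char -(fmorph_root f).
by rewrite map_char_poly /f /= -la.
Qed.

Lemma spectral_radiusP (R : realType) (n : nat) (G : sgraph 'I_n) :
  (0 < n)%N ->
  eigenvalue (adjmx R G) (spectral_radius R G) /\
  forall a, eigenvalue (adjmx R G) a -> a <= spectral_radius R G.
Proof.
move=> n0; set A := adjmx R G.
have [a ha] : exists a, eigenvalue A a.
  apply: symmx_eigenvalue => //; apply/matrixP=> i j; rewrite !mxE /adj.
  by case: G {A} => g /= /andP[_ /forallP/(_ i)/forallP/(_ j)/eqP->].
pose s := rootsR (char_poly A).
have hs x : eigenvalue A x = (x \in s).
  rewrite -(roots_on_rootsR (monic_neq0 (char_poly_monic A))) in_itv /=.
  exact: eigenvalue_root_char.
have [m [ms mM]] : exists m, m \in s /\ forall x, x \in s -> x <= m.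
  move: ha; rewrite hs; elim: s {hs} a => // y s IH a _.
  case: s IH => [|z s] IH.
    by exists y; rewrite inE; split=> // x /[!inE] /eqP->.
  have [m [ms mM]] := IH z (mem_head _ _).
  have [ym|my] := leP y m.
    exists m; rewrite inE ms orbT; split=> // x.
    by rewrite inE => /orP[/eqP->|/mM].
  exists y; rewrite mem_head; split=> // x; rewrite inE => /orP[/eqP->//|/mM xm].
  exact: le_trans xm (ltW my).
suff -> : spectral_radius R G = m by split=> [|x]; rewrite hs //; apply: mM.
have ub : ubound [set a | eigenvalue A a]%classic m.
  by move=> x /=; rewrite hs; apply: mM.
apply/eqP; rewrite eq_le; apply/andP; split.
  by apply: ge_sup => //; exists a.
by apply: ub_le_sup; [exists m|rewrite /= hs].
Qed.

(* Main.v *)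
(** Let x be the Perron vector of G, scaled to have maximum 1 = x z, and let
    l = l(G) >= n/2 - 1/2.  In an F_k-free graph every neighbourhood is
    independent up to 2k vertices.  If replacing the neighbourhood of v by J
    keeps the graph F_k-free, then x(J) <= l x_v by maximality of l; taking J
    to be the independent part of N(z) gives l x_v >= l - (2k+1) for every v,
    so all degrees are at least n/2 - O(k).  Such an F_k-free graph is nearly
    complete bipartite: there are sets S and T such that N(v) lies in S or in T
    for all but O(1) vertices v, while any 2k vertices of S, or of T, have many
    common neighbours.  Hence J may also be S or T, and with
    M = max (x(S), x(T)) we get M - 1 <= l x_v for all v and l x_v <= M for all
    but O(1) of them.  The Rayleigh bounds for y = (M - 1/2) 1 - l x then yield
    (M - 1/2)^2 (l n - 2 e(G)) <= 2 l |y|^2 < 2 (M - 1/2)^2 for large n.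
    Since 2 e(H) <= l(H) n <= l n for every F_k-free H, no such H has more
    edges than G. *)
Require Import Defs.
From HB Require Import structures.
From mathcomp Require Import classical_sets reals.
From mathcomp Require Import all_boot all_order all_algebra.
From mathcomp Require Import complex.
From mathcomp Require Import zify ring lra.

Set Implicit Arguments.
Unset Strict Implicit.
Unset Printing Implicit Defensive.

Import Order.TTheory GRing.Theory Num.Theory.

(** * Rayleigh quotients of symmetric matrices *)

Section Rayleigh.
Local Open Scope ring_scope.
Local Open Scope sesquilinear_scope.

(** In an orthonormal eigenbasis over [R[i]] the form at [y] is a sum of terms [d_i |w_i|^2], and
    each [d_i] is a real eigenvalue, hence at most [l]. *)
Lemma rayleigh_le (R : rcfType) (n : nat) (A : 'M[R]_n) (l : R) :
  A^T = A -> (forall a, eigenvalue A a -> a <= l) ->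
  forall y : 'rV_n, (y *m A *m y^T) 0 0 <= l * (y *m y^T) 0 0.
Proof.
move=> AT leA y.
pose f : {rmorphism R -> R[i]} := real_complex R.
pose B := map_mx f A; pose v := map_mx f y.
have fconj m p (M : 'M[R]_(m, p)) : (map_mx f M) ^ Num.conj = map_mx f M.
  by apply/matrixP=> i j; rewrite !mxE; apply/CrealP/complex_realP; eexists.
have Bherm : B \is hermsymmx.
  by apply/is_hermitianmxP; rewrite expr0 scale1r map_trmx AT fconj.
pose P := spectralmx B; pose d := spectral_diag B.
have PU : P \is unitarymx := spectral_unitarymx B.
have BE : B = P ^t* *m diag_mx d *m P.
  rewrite -invmx_unitary //; apply/orthomx_spectralP.
  exact: hermitian_normalmx.
have PP : P ^t* *m P = 1%:M.
  by rewrite -invmx_unitary // mulVmx // unitarymx_unit.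
pose w := v *m P ^t*.
have wt : w ^t* = P *m v ^T.
  by rewrite trmx_mul map_mxM /= trmxCK -map_trmx fconj.
have E1 : f ((y *m A *m y^T) 0 0) = \sum_i d 0 i * (w 0 i * (w 0 i)^* ).
  transitivity ((v *m B *m v^T) 0 0).
    by rewrite /v /B map_trmx -!map_mxM [RHS]mxE.
  rewrite BE !mulmxA -/w -mulmxA -wt mul_mx_diag !mxE.
  by apply: eq_bigr => i _; rewrite !mxE; ring.
have E2 : f ((y *m y^T) 0 0) = \sum_i (w 0 i * (w 0 i)^* ).
  transitivity ((v *m v^T) 0 0).
    by rewrite /v /B map_trmx -!map_mxM [RHS]mxE.
  have -> : v *m v^T = w *m w ^t*.
    by rewrite wt /w mulmxA -(mulmxA v) PP mulmx1.
  rewrite !mxE.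
  by apply: eq_bigr => i _; rewrite !mxE.
rewrite -lecR -[X in X <= _]/(f _) -[X in _ <= X]/(f _) rmorphM E1 E2 mulr_sumr.
apply: ler_sum => i _; apply: ler_wpM2r; first exact: mul_conjC_ge0.
have /mxOverP/(_ 0 i)/complex_realP [a da] := hermitian_spectral_diag_real Bherm.
have {da} dE : d 0 i = f a by exact: da.
rewrite dE; change (a%:C%C <= l%:C%C); rewrite lecR; apply: leA.
(* A real root of the characteristic polynomial over [R[i]] is one over [R], so a complex
   eigenvector suffices: a row of [P]. *)
rewrite eigenvalue_root_char -(fmorph_root f) map_char_poly -/B.
rewrite -eigenvalue_root_char; apply/eigenvalueP; exists (row i P).
  have PB : P *m B = diag_mx d *m P.
    by rewrite BE !mulmxA (unitarymxP PU) mul1mx.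
  rewrite -row_mul PB -dE; apply/rowP => j.
  by rewrite mul_diag_mx [LHS]mxE [RHS]mxE [LHS]mxE [X in _ = _ * X]mxE.
apply/eqP => Pi0; have := mulmxK (unitarymx_unit PU) (delta_mx 0 i : 'rV_n).
rewrite -rowE Pi0 mul0mx => /matrixP/(_ 0 i)/eqP.
by rewrite !mxE !eqxx eq_sym oner_eq0.
Qed.
End Rayleigh.

(** * Perron vectors and changes of a neighbourhood *)

Section Neighborhoods.
Variables (V : finType) (G : sgraph V).

Definition nbhd (v : V) : {set V} := [set u | adj G v u].

Lemma adjC : symmetric (adj G).
Proof.
move=> x y; rewrite /adj; case: G => g /= /andP[_].
by move=> /forallP/(_ x)/forallP/(_ y)/eqP ->.
Qed.

Lemma adj_irr x : adj G x x = false.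
Proof. by rewrite /adj; case: G => g /= /andP[/forallP/(_ x)/negbTE]. Qed.

Lemma in_nbhd u v : (u \in nbhd v) = adj G v u.
Proof. by rewrite inE. Qed.

Lemma adj_neq x y : adj G x y -> x != y.
Proof. by apply: contraTneq => ->; rewrite adj_irr. Qed.

Lemma sum_nbhd : \sum_v #|nbhd v| = (#|edges G| * 2)%N.
Proof.
pose P := [set p : V * V | adj G p.1 p.2].
pose e (p : V * V) := [set p.1; p.2].
have -> : \sum_v #|nbhd v| = #|P|.
  rewrite -sum1_card (eq_bigl (fun p => adj G p.1 p.2)); last first.
    by move=> p; rewrite inE.
  rewrite (eq_bigr (fun v => \sum_(u | adj G v u) 1)%N); last first.
    by move=> v _; rewrite -sum1_card; apply: eq_bigl => u; rewrite in_nbhd.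
  by rewrite (pair_big_dep xpredT (fun v u => adj G v u)).
rewrite -sum1_card (partition_big e (mem (edges G))) /=; last first.
  by move=> p; rewrite inE => Pp; apply/imsetP; exists p; rewrite ?inE.
rewrite -sum_nat_const; apply: eq_bigr => f /imsetP [[x y]].
rewrite inE /= => xy ->; have nxy := adj_neq xy.
rewrite sum1_card -(_ : #|[set (x, y); (y, x)]| = 2); last first.
  by rewrite cards2 xpair_eqE (eq_sym y) andbb nxy.
apply: eq_card => -[a b]; rewrite !inE /e /= !xpair_eqE.
apply/andP/orP => [[ab /eqP E]|].
  have : a \in [set x; y] by rewrite -E set21.
  have : b \in [set x; y] by rewrite -E set22.
  move: ab nxy; rewrite !inE => ab nxy /orP[] /eqP bE /orP[] /eqP aE; subst.
  - by rewrite adj_irr in ab.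
  - by right; rewrite !eqxx.
  - by left; rewrite !eqxx.
  - by rewrite adj_irr in ab.
by move=> [] /andP[/eqP -> /eqP ->]; rewrite inE /= ?xy // adjC setUC xy.
Qed.

End Neighborhoods.

(** * Replacing the neighbourhood of one vertex *)

Fact rel_graph_subproof (V : finType) (r : rel V)
    (g := [ffun p => (p.1 != p.2) && (r p.1 p.2 || r p.2 p.1)]) :
  [forall x, ~~ g (x, x)] && [forall x, forall y, g (x, y) == g (y, x)].
Proof.
apply/andP; split; first by apply/forallP => x; rewrite ffunE eqxx.
apply/forallP => x; apply/forallP => y.
by rewrite !ffunE /= (eq_sym x) orbC.
Qed.

(** Any relation is accepted, symmetrised and stripped of its diagonal, so a graph can be given by a
    one-sided rule. *)
Definition rel_graph (V : finType) (r : rel V) : sgraph V :=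
  SGraph (rel_graph_subproof r).

Lemma adj_rel_graph (V : finType) (r : rel V) x y :
  adj (rel_graph r) x y = (x != y) && (r x y || r y x).
Proof. by rewrite /adj ffunE. Qed.

(** The test [y != v] removes the old edges at [v], which symmetrisation would otherwise bring
    back. *)
Definition reattach (V : finType) (G : sgraph V) (v : V) (J : {set V}) :=
  rel_graph (fun x y => if x == v then y \in J else (y != v) && adj G x y).

Lemma reattach_off (V : finType) (G : sgraph V) v J x y :
  x != v -> y != v -> adj (reattach G v J) x y = adj G x y.
Proof.
move=> xv yv; rewrite adj_rel_graph (negbTE xv) (negbTE yv) /= (adjC G y) orbb.
by rewrite andbC; case: (boolP (adj G x y)) => // /adj_neq ->.
Qed.

Lemma nbhd_reattach (V : finType) (G : sgraph V) v (J : {set V}) :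
  v \notin J -> nbhd (reattach G v J) v = J.
Proof.
move=> vJ; apply/setP => u; rewrite in_nbhd adj_rel_graph !eqxx /=.
case: eqVneq => [<-|uv]; first by rewrite (negbTE vJ).
by rewrite orbF.
Qed.

(** * Quadratic forms and the Perron vector *)

Section Spectral.
Local Open Scope ring_scope.
Variable R : realType.

Definition quad n (G : sgraph 'I_n) (x : 'I_n -> R) : R :=
  \sum_i \sum_(j in nbhd G i) x i * x j.

Definition quad_off n (G : sgraph 'I_n) (v : 'I_n) (x : 'I_n -> R) : R :=
  \sum_(i | i != v) \sum_(j in nbhd G i | j != v) x i * x j.

Lemma quad_split n (G : sgraph 'I_n) (v : 'I_n) (x : 'I_n -> R) :
  quad G x = quad_off G v x + 2 * x v * \sum_(j in nbhd G v) x j.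
Proof.
rewrite /quad (bigD1 v) //= -mulr_sumr.
have -> : \sum_(i | i != v) \sum_(j in nbhd G i) x i * x j =
    \sum_(i | i != v) (\sum_(j in nbhd G i | j != v) x i * x j
       + if i \in nbhd G v then x v * x i else 0).
  apply: eq_bigr => i iv; rewrite !in_nbhd adjC.
  have [iv'|iv'] := boolP (adj G i v).
    by rewrite (bigD1 v) ?in_nbhd //= addrC mulrC.
  rewrite addr0; apply: eq_bigl => j; rewrite in_nbhd.
  by case: (eqVneq j v) => [->|]; rewrite ?(negbTE iv') ?andbT.
rewrite big_split /= -big_mkcondr.
rewrite [\sum_(i | _ && _) _](eq_bigl (fun i => i \in nbhd G v)); last first.
  by move=> i; case: (eqVneq i v) => // ->; rewrite in_nbhd adj_irr.
by rewrite -mulr_sumr /quad_off; ring.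
Qed.

Lemma spectral_rayleigh n (G : sgraph 'I_n) (x : 'I_n -> R) :
  quad G x <= spectral_radius R G * \sum_i x i ^+ 2.
Proof.
case: n G x => [|n] G x; first by rewrite /quad !big_ord0 mulr0.
have [_ leG] := @spectral_radiusP R _ G isT.
set y : 'rV[R]_n.+1 := \row_i x i; set A := adjmx R G.
have -> : quad G x = (y *m A *m y^T) 0 0.
  rewrite -mulmxA !mxE; apply: eq_bigr => i _.
  rewrite !mxE mulr_sumr big_mkcond; apply: eq_bigr => j _.
  rewrite in_nbhd !mxE; case: (adj G i j); rewrite ?mul1r //.
  by rewrite mul0r mulr0.
have -> : \sum_i x i ^+ 2 = (y *m y^T) 0 0.
  by rewrite mxE; apply: eq_bigr => i _; rewrite !mxE expr2.
by apply: rayleigh_le => //; apply/matrixP => i j; rewrite !mxE adjC.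
Qed.

(** Rayleigh bound for [H] at [x] with its entry at [v] replaced by [s]. The graphs agree off [v],
    so on the left only the term in [s] sees [H]. *)
Lemma rayleigh_coord n (G H : sgraph 'I_n) (v : 'I_n) (x : 'I_n -> R) (s : R) :
  (forall i j, i != v -> j != v -> adj H i j = adj G i j) ->
  quad_off G v x + 2 * s * (\sum_(j in nbhd H v) x j) <=
  spectral_radius R H * (\sum_(i | i != v) x i ^+ 2 + s ^+ 2).
Proof.
move=> GH; pose y i := if i == v then s else x i.
have yv : y v = s by rewrite /y eqxx.
have yE i : i != v -> y i = x i by move=> /negbTE iv; rewrite /y iv.
have <- : quad_off H v y = quad_off G v x.
  apply: eq_bigr => i iv; rewrite yE //; apply: eq_big => j.
    rewrite !in_nbhd; case: (boolP (j == v)) => jv; rewrite ?andbF //.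
    by rewrite GH.
  by move=> /andP[_ /yE ->].
have <- : \sum_(j in nbhd H v) y j = \sum_(j in nbhd H v) x j.
  by apply: eq_bigr => j; rewrite in_nbhd => /adj_neq; rewrite eq_sym => /yE.
have -> : \sum_(i | i != v) x i ^+ 2 + s ^+ 2 = \sum_i y i ^+ 2.
  rewrite [RHS](bigD1 v) //= yv addrC; congr (_ + _).
  by apply: eq_bigr => j /yE ->.
by rewrite -yv -quad_split spectral_rayleigh.
Qed.

(** Near 0 a nonzero linear term beats a quadratic one; [t = c / (|l| + 1)] is small enough. *)
Lemma linear_le_quadratic (F : realFieldType) (c l : F) :
  (forall t, 2 * t * c <= l * t ^+ 2) -> c = 0.
Proof.
move=> /(_ (c / (`|l| + 1))); have := normr_ge0 l; have := ler_norm l.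
move: `|l| => m lm m0; have m1 : m + 1 != 0 by lra.
set t := c / _; have cE : c = t * (m + 1) by rewrite /t divfK.
rewrite cE => tl; have /eqP : t ^+ 2 = 0.
  by apply/eqP; rewrite eq_le sqr_ge0 andbT; nra.
by rewrite sqrf_eq0 => /eqP ->; rewrite mul0r.
Qed.

(** The absolute values of an eigenvector maximise the Rayleigh quotient, and stationarity in each
    coordinate is the eigenvector equation. Dividing by the largest entry makes the maximum 1. *)
Lemma perron n (G : sgraph 'I_n) : (0 < n)%N ->
  exists x : 'I_n -> R, [/\ forall i, 0 <= x i <= 1, exists z, x z = 1 &
    forall i, spectral_radius R G * x i = \sum_(j in nbhd G i) x j].
Proof.
move=> n0; set l := spectral_radius R G.
have [/eigenvalueP[v vA v0] _] := @spectral_radiusP R _ G n0.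
pose y (i : 'I_n) : R := `|v 0 i|.
have vE i : l * v 0 i = \sum_(j in nbhd G i) v 0 j.
  have /rowP/(_ i) := vA; rewrite !mxE => <-.
  rewrite [RHS]big_mkcond; apply: eq_bigr => j _; rewrite mxE in_nbhd adjC.
  by case: (adj G i j); rewrite ?mulr1 ?mulr0.
have qy : l * \sum_i y i ^+ 2 <= quad G y.
  rewrite mulr_sumr; apply: ler_sum => i _.
  rewrite -mulr_sumr /y -normrX ger0_norm ?sqr_ge0 // expr2 mulrA vE.
  rewrite mulrC; apply: le_trans (ler_norm _) _; rewrite normrM.
  by apply: ler_wpM2l => //; apply: ler_norm_sum.
have yE i : l * y i = \sum_(j in nbhd G i) y j.
  set g := \sum_(j in _) _.
  have ub s := @rayleigh_coord n G G i y s (fun _ _ _ _ => erefl).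
  move: qy; rewrite (quad_split _ i) (bigD1 i) //= -/g -/l.
  move: ub; rewrite -/l -/g; move: (quad_off _ _ _) (\sum_(j | _) _) => q w ub qy.
  (* Moving coordinate [i] by [t] changes the form minus [l |y|^2] by [2 t (g - l y_i) - l t^2],
     which cannot be positive. *)
  suff : g - l * y i = 0 by lra.
  apply: (@linear_le_quadratic _ _ l) => t.
  by have := ub (y i + t); lra.
pose z := [arg max_(i > Ordinal n0) y i]%O.
have zmax i : y i <= y z by rewrite /z; case: arg_maxP => // j _; apply.
have z0 : 0 < y z.
  rewrite lt_def normr_ge0 andbT; apply: contra_neq v0 => yz; apply/rowP => i.
  by rewrite mxE; apply/normr0_eq0/eqP; rewrite eq_le normr_ge0 -yz zmax.
exists (fun i => y i / y z); split.
- by move=> i; rewrite divr_ge0 ?normr_ge0 //= ler_pdivrMr // mul1r zmax.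
- by exists z; rewrite divff // gt_eqF.
- by move=> i; rewrite mulrA yE mulr_suml.
Qed.

(* Optimise the Rayleigh bound for the new graph over the weight given to [v],
   all other weights being those of the Perron vector [x]. *)
Lemma reattach_sum_le n (G : sgraph 'I_n) (x : 'I_n -> R) v (J : {set 'I_n}) :
  let l := spectral_radius R G in
  0 < l -> (forall i, 0 <= x i) ->
  (forall i, l * x i = \sum_(j in nbhd G i) x j) ->
  v \notin J -> spectral_radius R (reattach G v J) <= l ->
  \sum_(j in J) x j <= l * x v.
Proof.
move=> l l0 x0 xE vJ le_l.
have ub s := @rayleigh_coord n G (reattach G v J) v x s (@reattach_off _ G v J).
have q0 : quad_off G v x = l * (\sum_(i | i != v) x i ^+ 2 - x v ^+ 2).
  have := quad_split G v x; rewrite -xE => /eqP.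
  rewrite /quad (eq_bigr (fun i => l * x i ^+ 2)); last first.
    by move=> i _; rewrite -mulr_sumr -xE; ring.
  rewrite -mulr_sumr (bigD1 v) //= => /eqP; lra.
set P := \sum_(j in J) _.
have P0 : 0 <= P by apply: sumr_ge0.
have w0 : 0 <= \sum_(i | i != v) x i ^+ 2.
  by apply: sumr_ge0 => i _; apply: sqr_ge0.
(* The weight [s = P / l] maximises [2 s P - l s^2]. *)
have := ub (P / l); rewrite nbhd_reattach // q0 -/P.
move: (\sum_(i | _) _) w0 => w w0 {}ub.
have {}ub := le_trans ub (ler_wpM2r (addr_ge0 w0 (sqr_ge0 (P / l))) le_l).
set t := P / l in ub; have PE : P = l * t by rewrite /t mulrC divfK // gt_eqF.
rewrite PE in P0 ub *; rewrite ler_pM2l //.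
rewrite pmulr_rge0 // in P0.
have {}ub : l * t ^+ 2 <= l * x v ^+ 2 by nra.
by move: ub; rewrite ler_pM2l // ler_sqr // nnegrE.
Qed.

End Spectral.

(** * Fan-free graphs of large minimum degree *)

Section Combinatorics.
Variables (V : finType) (k : nat).
Implicit Types (G : sgraph V) (I J Q S T U X : {set V}).

Definition independent G I :=
  forall a b, a \in I -> b \in I -> ~~ adj G a b.

Definition common_nbhd G Q : {set V} := [set w | Q \subset nbhd G w].

Lemma contains_copyP (U : finType) (H : sgraph U) G :
  reflect (exists2 f : U -> V, injective f &
             forall x y, adj H x y -> adj G (f x) (f y))
          (contains_copy H G).
Proof.
apply: (iffP existsP) => [[f /andP[/injectiveP fi /forallP fa]]|[f fi fa]].
  exists f => // x y xy.
  by have /forallP/(_ y)/implyP := fa x; apply.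
exists (finfun f); apply/andP; split.
  by apply/injectiveP => x y; rewrite !ffunE => /fi.
by apply/forallP => x; apply/forallP => y; apply/implyP; rewrite !ffunE => /fa.
Qed.

Lemma matching_or_cover G v j :
  (exists s : seq (V * V), [/\ size s = j, uniq (unzip1 s ++ unzip2 s),
     {subset unzip1 s ++ unzip2 s <= nbhd G v} &
     all (fun p => adj G p.1 p.2) s]) \/
  (exists2 X : {set V}, #|X| <= j * 2 & independent G (nbhd G v :\: X)).
Proof.
elim: j => [|j [[s [sz us sN sA]]|[X Xj Xi]]]; first by left; exists [::].
  pose X := [set u in unzip1 s ++ unzip2 s].
  have Xj : #|X| <= j * 2.
    rewrite cardsE; apply: leq_trans (card_size _) _.
    by rewrite size_cat !size_map sz muln2 addnn.
  case: (boolP [forall a in nbhd G v :\: X, forall b in nbhd G v :\: X,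
                  ~~ adj G a b]) => [/forall_inP ind|].
    right; exists X; first by apply: leq_trans Xj _; rewrite leq_mul2r leqnSn orbT.
    by move=> a b aX bX; have /forall_inP := ind a aX; apply.
  rewrite negb_forall_in => /exists_inP [a aX].
  rewrite negb_forall_in => /exists_inP [b bX]; rewrite negbK => ab; left.
  move: aX bX; rewrite !in_setD !inE => /andP[aX av] /andP[bX bv].
  have nab := adj_neq ab.
  exists ((a, b) :: s); split; rewrite /= ?sz ?ab ?sA //.
    rewrite -(cat1s b) uniq_catCA /= us andbT bX andbT.
    by move: aX; rewrite !mem_cat inE !negb_or nab andTb.
  move=> u; rewrite inE mem_cat inE.
  have := sN u; rewrite mem_cat => su.
  case/or4P=> [/eqP->|us1|/eqP->|us2]; rewrite ?in_nbhd //.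
    by rewrite -in_nbhd su // us1.
  by rewrite -in_nbhd su // us2 orbT.
by right; exists X => //; apply: leq_trans Xj _; rewrite leq_mul2r leqnSn orbT.
Qed.

(** A matching of [k] edges inside the neighbourhood of [v] would form a fan with centre [v]. *)
Lemma fan_free_cover G v : graph_free (fan k) G ->
  exists2 X : {set V}, #|X| <= k * 2 & independent G (nbhd G v :\: X).
Proof.
move=> /negP free; case: (matching_or_cover G v k) => // -[s [sz us sN sA]].
case: free; apply/contains_copyP.
pose t := unzip1 s ++ unzip2 s.
have szt : size t = k + k by rewrite size_cat !size_map sz.
(* [t] lists the first ends of the [k] edges, then the second ends; [pos (i, b)] is the place of end
   [b] of edge [i]. *)
pose pos (p : 'I_k * bool) : nat := if p.2 then k + p.1 else p.1.
have post p : pos p < size t.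
  by case: p => i b; rewrite szt /pos /=; have := ltn_ord i; case: b; lia.
have posI : injective pos.
  move=> [i a] [j b]; rewrite /pos /= => E.
  have := ltn_ord i; have := ltn_ord j.
  have ij : a = b -> i = j by move=> ab; apply: val_inj; case: a b E ab => -[] /=; lia.
  by case: a b E ij => -[] /= E ij ? ?; rewrite ?ij //; lia.
have tv p : nth v t (pos p) \in nbhd G v by apply/sN/mem_nth.
pose f (x : option ('I_k * bool)) := if x is Some p then nth v t (pos p) else v.
have adjt i : adj G (nth v t (pos (i, false))) (nth v t (pos (i, true))).
  rewrite /t /pos /= !nth_cat !size_map sz ltn_ord.
  rewrite ltnNge leq_addr /= addKn /unzip1 /unzip2.
  rewrite !(nth_map (v, v)) ?sz //.
  by move/all_nthP: sA; apply; rewrite sz.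
exists f.
  have vt p : nth v t (pos p) != v.
    by have := tv p; rewrite in_nbhd => /adj_neq; rewrite eq_sym.
  move=> [p|] [q|] //= E; last 2 first.
  - by have := vt p; rewrite E eqxx.
  - by have := vt q; rewrite -E eqxx.
  by move/eqP: E; rewrite nth_uniq // => /eqP /posI ->.
have tv' p : adj G v (nth v t (pos p)) by rewrite -in_nbhd.
move=> [[i a]|] [[j b]|] //=; rewrite /adj ffunE //=.
  move=> /andP[/eqP <-] ab; rewrite -/(adj G _ _).
  by case: a b ab => -[] // _; rewrite // adjC.
by rewrite -/(adj G _ _) adjC.
Qed.

Lemma reattach_copy_hits (U : finType) (H : sgraph U) G v J (f : U -> V) :
  graph_free H G -> injective f ->
  (forall x y, adj H x y -> adj (reattach G v J) (f x) (f y)) ->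
  exists a, f a = v.
Proof.
move=> /negP free fi fa.
case: (boolP [exists a, f a == v]) => [/existsP[a /eqP av]|]; first by exists a.
rewrite negb_exists => /forallP fv; case: free; apply/contains_copyP.
by exists f => // x y /fa; rewrite reattach_off.
Qed.

Lemma fan_triangle (a : option ('I_k * bool)) : 0 < k ->
  exists b c, [/\ adj (fan k) a b, adj (fan k) a c & adj (fan k) b c].
Proof.
move=> k0; case: a => [[i e]|].
  exists None, (Some (i, ~~ e)); rewrite /adj !ffunE /= eqxx.
  by split=> //; case: e.
by exists (Some (Ordinal k0, false)), (Some (Ordinal k0, true));
  rewrite /adj !ffunE /= ?eqxx.
Qed.

(** A fan in the new graph must use [v], and every fan vertex lies in a triangle, whose other two
    corners would be adjacent vertices of [J]. *)
Lemma free_reattach_independent G v J :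
  0 < k -> graph_free (fan k) G -> v \notin J -> independent G J ->
  graph_free (fan k) (reattach G v J).
Proof.
move=> k0 free vJ Ji; apply/negP => /contains_copyP [f fi fa].
have [a av] := reattach_copy_hits free fi fa.
have [b [c [ab ac bc]]] := fan_triangle a k0.
have inJ x : adj (fan k) a x -> f x \in J.
  by move/fa; rewrite av -in_nbhd nbhd_reattach.
have := fa _ _ bc; rewrite reattach_off ?(negbTE (Ji _ _ _ _)) ?inJ //.
- by apply: contraNneq vJ => <-; apply: inJ.
- by apply: contraNneq vJ => <-; apply: inJ.
Qed.

(* In a fan using [v], the vertex [v] can be exchanged for an unused common
   neighbour of its at most [2k] neighbours in the fan. *)
Lemma free_reattach_common G v J :
  graph_free (fan k) G -> v \notin J ->
  (forall Q, Q \subset J -> #|Q| <= k * 2 -> (k * 2).+1 < #|common_nbhd G Q|) ->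
  graph_free (fan k) (reattach G v J).
Proof.
move=> free vJ Jc; apply/negP => /contains_copyP [f fi fa].
have [a av] := reattach_copy_hits free fi fa.
have cU : #|{: option ('I_k * bool)}| = (k * 2).+1.
  by rewrite card_option card_prod card_ord card_bool.
pose Q := f @: nbhd (fan k) a.
have QJ : Q \subset J.
  apply/subsetP => _ /imsetP[x xa ->]; move: xa; rewrite in_nbhd => /fa.
  by rewrite av -in_nbhd nbhd_reattach.
have cQ : #|Q| <= k * 2.
  apply: leq_trans (leq_imset_card _ _) _; rewrite -ltnS -cU -cardsT.
  apply: proper_card; rewrite properT; apply/negP => /eqP E.
  have : a \in [set: option ('I_k * bool)] by [].
  by rewrite -E in_nbhd adj_irr.
have : ~~ (common_nbhd G Q \subset f @: [set: option ('I_k * bool)]).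
  apply/negP => /subset_leq_card; rewrite card_imset // cardsT cU leqNgt.
  by rewrite Jc.
case/subsetPn => w; rewrite inE => /subsetP Qw wf.
have wx x : w != f x by apply: contraNneq wf => ->; apply: imset_f.
case/negP: free; apply/contains_copyP.
pose g x := if x == a then w else f x.
exists g => [x y|x y xy].
  rewrite /g; case: eqVneq => [->|xa]; case: eqVneq => [->|ya] //.
  - by move=> E; have := wx y; rewrite E eqxx.
  - by move=> E; have := wx x; rewrite E eqxx.
  - exact: fi.
have aw z : adj (fan k) a z -> adj G w (f z).
  by move=> az; rewrite -in_nbhd; apply: Qw; apply: imset_f; rewrite in_nbhd.
have nv z : z != a -> f z != v by rewrite -av (inj_eq fi).
move: xy; rewrite /g; case: (eqVneq x a) => [->|xa].
  case: (eqVneq y a) => [->|ya]; first by rewrite adj_irr.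
  exact: aw.
case: (eqVneq y a) => [->|ya]; first by rewrite adjC => /aw; rewrite adjC.
by move/fa; rewrite reattach_off ?nv.
Qed.

Lemma leq_card_bigcup (I : finType) (A : {set I}) (F : I -> {set V}) :
  #|\bigcup_(i in A) F i| <= \sum_(i in A) #|F i|.
Proof.
elim/big_rec2: _ => [|i n B _ IH]; first by rewrite cards0.
by apply: leq_trans (leq_card_setU _ _) _; rewrite leq_add2l.
Qed.

(** Union bound: each vertex of [Q] excludes at most [m] vertices of [I]. *)
Lemma card_common_nbhd G I Q m :
  (forall q, q \in Q -> #|I :\: nbhd G q| <= m) ->
  #|I| <= #|common_nbhd G Q| + #|Q| * m.
Proof.
move=> Qm; pose B := \bigcup_(q in Q) (I :\: nbhd G q).
have cB : #|B| <= #|Q| * m.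
  rewrite -sum_nat_const; apply: leq_trans (leq_card_bigcup _ _) _.
  exact: leq_sum.
rewrite -(cardsID B I) addnC; apply: leq_add; last first.
  by apply: leq_trans (subset_leq_card (subsetIr _ _)) cB.
apply: subset_leq_card; apply/subsetP => w; rewrite !inE => /andP[wB wI].
apply/subsetP => q qQ; rewrite in_nbhd adjC; apply: contraNT wB => qw.
by apply/bigcupP; exists q => //; rewrite !inE qw.
Qed.

(** For [w] in the independent part of [N(v)], the set [N(w)] avoids that part, so their sizes add
    up to at most [|V|]. *)
Lemma max_degree G c v :
  graph_free (fan k) G -> (forall u, #|V| <= #|nbhd G u| * 2 + c) ->
  k * 4 + c < #|V| -> #|nbhd G v| * 2 <= #|V| + (c + k * 4).
Proof.
move=> free deg nV; have [X Xk Xi] := fan_free_cover v free.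
have dX := cardsID X (nbhd G v).
have cX := subset_leq_card (subsetIr (nbhd G v) X).
have dv := deg v.
have /card_gt0P [w wI] : 0 < #|nbhd G v :\: X| by lia.
have : [disjoint nbhd G w & nbhd G v :\: X].
  rewrite disjoints_subset; apply/subsetP => u; rewrite in_nbhd in_setC => wu.
  by apply: contraL wu => uI; apply: Xi.
rewrite -leq_card_setU => /eqP cU.
have := max_card (mem (nbhd G w :|: (nbhd G v :\: X))); rewrite cU.
by have := deg w; lia.
Qed.

(** [I] comes from [N(v)] and [J] from [N(w)] with [w] in [I], each after deleting at most [2k]
    vertices; no neighbour of [w] lies in the independent set [I]. *)
Lemma near_bipartition G c :
  graph_free (fan k) G -> (forall u, #|V| <= #|nbhd G u| * 2 + c) ->
  k * 4 + c < #|V| ->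
  exists I J, [/\ [disjoint I & J], independent G I, independent G J,
    #|V| <= #|I| * 2 + (c + k * 4) & #|V| <= #|J| * 2 + (c + k * 4)].
Proof.
move=> free deg nV; have /card_gt0P [v _] : 0 < #|V| by lia.
have large u X : #|X| <= k * 2 -> #|V| <= #|nbhd G u :\: X| * 2 + (c + k * 4).
  move=> Xk; have := cardsID X (nbhd G u); have := deg u.
  by have := subset_leq_card (subsetIr (nbhd G u) X); lia.
have [X Xk Xi] := fan_free_cover v free.
have /card_gt0P [w wI] : 0 < #|nbhd G v :\: X| by have := large v X Xk; lia.
have [Y Yk Yi] := fan_free_cover w free.
exists (nbhd G v :\: X), (nbhd G w :\: Y); split; rewrite ?large //.
rewrite disjoint_sym disjoints_subset; apply/subsetP => u.
rewrite in_setD in_nbhd => /andP[_ wu]; rewrite in_setC.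
by apply: contraL wu => uI; apply: Xi.
Qed.

(** At most [d] vertices lie outside both parts, so almost all neighbours of [v] outside [J] fall in
    [I], which has at most [(|V| + d) / 2] vertices. *)
Lemma card_missing I J G c d v :
  [disjoint I & J] -> #|V| <= #|nbhd G v| * 2 + c ->
  #|V| <= #|I| * 2 + d -> #|V| <= #|J| * 2 + d ->
  #|I :\: nbhd G v| * 2 <= c + d * 3 + #|nbhd G v :&: J| * 2.
Proof.
move=> IJ degv nI nJ.
have cIJ : #|I :|: J| = #|I| + #|J| by apply/eqP; rewrite leq_card_setU.
have cC := cardsC (I :|: J).
have := cardsID (nbhd G v) I; rewrite setIC => cI.
have : #|nbhd G v| <= #|nbhd G v :&: I| + #|nbhd G v :&: J| + #|~: (I :|: J)|.
  rewrite -(cardsID (I :|: J)) leq_add //.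
    by rewrite setIUr (leq_trans (leq_card_setU _ _)).
  by apply: subset_leq_card; rewrite setDE subsetIr.
lia.
Qed.

(** Off the cover [X], a neighbour of [v] in [I] is adjacent to none of the neighbours of [v] in
    [J], of which at least [K - 2k] remain; but a vertex of [I] misses fewer vertices of [J] than
    that. *)
Lemma few_neighbors_one_side G I J c d K v :
  graph_free (fan k) G -> independent G I ->
  (forall u, #|V| <= #|nbhd G u| * 2 + c) ->
  [disjoint I & J] ->
  #|V| <= #|I| * 2 + d -> #|V| <= #|J| * 2 + d ->
  c + d * 3 + k * 4 < K * 2 ->
  K <= #|nbhd G v :&: I| -> K <= #|nbhd G v :&: J| -> False.
Proof.
move=> free Ii deg IJ nI nJ cK KI KJ; have [X Xk Xi] := fan_free_cover v free.
have cX T : #|T| <= #|T :\: X| + k * 2.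
  rewrite -(cardsID X T) addnC leq_add2l (leq_trans _ Xk) //.
  by rewrite subset_leq_card // subsetIr.
have /card_gt0P [a] : 0 < #|(nbhd G v :&: I) :\: X|.
  by have := cX (nbhd G v :&: I); lia.
rewrite !in_setD in_setI => /and3P[aX av aI].
have : (nbhd G v :&: J) :\: X \subset J :\: nbhd G a.
  apply/subsetP => b; rewrite !in_setD in_setI => /and3P[bX bv ->].
  by rewrite andbT in_nbhd; apply: Xi; rewrite in_setD ?aX ?bX.
move=> /subset_leq_card; have := cX (nbhd G v :&: J).
have JI : [disjoint J & I] by rewrite disjoint_sym.
have := card_missing JI (deg a) nJ nI.
have -> : nbhd G a :&: I = set0.
  apply/setP => b; rewrite in_setI in_nbhd in_set0; apply/negP => /andP[ab bI].
  by have := Ii a b aI bI; rewrite ab.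
rewrite cards0; lia.
Qed.

(* A vertex of [T] has few neighbours in [J], hence misses few vertices of
   [I].  A vertex outside [T] adjacent to [I] lies in neither [I] nor [J], and
   has fewer than [K] neighbours in [I]. *)
Lemma one_side G I J c d K (T := [set v | #|nbhd G v :&: J| < K]) :
  graph_free (fan k) G -> independent G I -> independent G J ->
  (forall u, #|V| <= #|nbhd G u| * 2 + c) ->
  [disjoint I & J] ->
  #|V| <= #|I| * 2 + d -> #|V| <= #|J| * 2 + d ->
  c + d * 3 + k * 4 < K * 2 ->
  (k * 2 * (c + d * 3 + K * 2) + k * 2).+2 * 2 + d <= #|V| ->
  (forall Q, Q \subset T -> #|Q| <= k * 2 -> (k * 2).+1 < #|common_nbhd G Q|) /\
  #|[set v in I | ~~ (nbhd G v \subset T)]| <= d * K.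
Proof.
move=> free Ii Ji deg IJ nI nJ cK nV; split.
  move=> Q QT cQ; set m := c + d * 3 + K * 2 in nV.
  have := @card_common_nbhd G I Q m; set C := #|common_nbhd G Q| => cc.
  have {}cc : #|I| <= C + #|Q| * m.
    apply: cc => q /(subsetP QT); rewrite inE => qJ.
    by have := card_missing IJ (deg q) nI nJ; lia.
  have : #|Q| * m <= k * 2 * m by rewrite leq_mul2r cQ orbT.
  move: nV; move: (k * 2 * m) (#|Q| * m) cc => x y; lia.
pose W := [set u in ~: (I :|: J) | #|nbhd G u :&: I| < K].
have cW : #|W| <= d.
  have cIJ : #|I :|: J| = #|I| + #|J| by apply/eqP; rewrite leq_card_setU.
  have := cardsC (I :|: J).
  have : #|W| <= #|~: (I :|: J)|.
    by apply: subset_leq_card; apply/subsetP => u; rewrite inE => /andP[].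
  lia.
apply: (@leq_trans #|\bigcup_(u in W) (nbhd G u :&: I)|); last first.
  apply: leq_trans (leq_card_bigcup _ _) _.
  apply: (@leq_trans (\sum_(u in W) K)).
    by apply: leq_sum => u; rewrite inE => /andP[_ /ltnW].
  by rewrite sum_nat_const leq_mul2r cW orbT.
apply: subset_leq_card; apply/subsetP => v; rewrite inE => /andP[vI].
case/subsetPn => u; rewrite in_nbhd inE -leqNgt => vu uJ.
apply/bigcupP; exists u; last by rewrite in_setI in_nbhd adjC vu.
have uI : #|nbhd G u :&: I| < K.
  rewrite ltnNge; apply/negP => uI.
  exact: (few_neighbors_one_side free Ii deg IJ nI nJ cK uI uJ).
rewrite inE uI andbT in_setC in_setU negb_or; apply/andP; split.
  by apply: contraL vu => uI'; apply: Ii.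
(* A vertex of [J] has no neighbour in [J], so it belongs to [T] because [K > 0]. *)
apply/negP => uJ'; have := cK; suff : K = 0 by lia.
apply/eqP; rewrite -leqn0 (leq_trans uJ) // leqn0 cards_eq0; apply/eqP/setP => w.
rewrite in_setI in_nbhd in_set0; apply/negP => /andP[uw wJ].
by have := Ji u w uJ' wJ; rewrite uw.
Qed.

End Combinatorics.

(** [S] and [T] enlarge the parts [I] and [J] by the vertices with few neighbours in that part. [U]
    holds the vertices outside both parts and those whose neighbourhood leaves the opposite enlarged
    part. *)
Lemma fan_free_structure k c : exists N C, forall (V : finType) (G : sgraph V),
  graph_free (fan k) G -> (forall u, #|V| <= #|nbhd G u| * 2 + c) ->
  N <= #|V| ->
  exists S T U : {set V}, [/\ #|U| <= C,
    forall v, v \notin U -> nbhd G v \subset S \/ nbhd G v \subset T,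
    forall Q : {set V}, Q \subset S -> #|Q| <= k * 2 -> (k * 2).+1 < #|common_nbhd G Q| &
    forall Q : {set V}, Q \subset T -> #|Q| <= k * 2 -> (k * 2).+1 < #|common_nbhd G Q|].
Proof.
(* [d] is the defect of the near-bipartition; [K] is large enough that no vertex has [K] neighbours
   in both parts. *)
pose d := c + k * 4; pose K := c + d * 3 + k * 4 + 1.
exists ((k * 4 + c).+1 + ((k * 2 * (c + d * 3 + K * 2) + k * 2).+2 * 2 + d)).
exists (d + (d * K + d * K)) => V G free deg nV.
have [|I [J [IJ Ii Ji nI nJ]]] := near_bipartition free deg.
  by apply: leq_trans nV; apply: leq_addr.
have JI : [disjoint J & I] by rewrite disjoint_sym.
have cK : c + d * 3 + k * 4 < K * 2 by rewrite /K; lia.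
have nV' := leq_trans (leq_addl _ _) nV.
have [P1 U1] := one_side free Ii Ji deg IJ nI nJ cK nV'.
have [P2 U2] := one_side free Ji Ii deg JI nJ nI cK nV'.
set T := [set v | #|nbhd G v :&: J| < K] in P1 U1.
set S := [set v | #|nbhd G v :&: I| < K] in P2 U2.
exists S, T, (~: (I :|: J) :|: ([set v in I | ~~ (nbhd G v \subset T)] :|:
                                [set v in J | ~~ (nbhd G v \subset S)])).
split=> //.
  have cIJ : #|I :|: J| = #|I| + #|J| by apply/eqP; rewrite leq_card_setU.
  apply: leq_trans (leq_card_setU _ _) _; apply: leq_add.
    by have := cardsC (I :|: J); rewrite -/d in nI nJ; lia.
  by apply: leq_trans (leq_card_setU _ _) _; apply: leq_add.
move=> v; case: (boolP (nbhd G v \subset T)) => nT; first by right.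
case: (boolP (nbhd G v \subset S)) => nS; first by left.
by rewrite !inE nS nT; case: (v \in I); case: (v \in J).
Qed.

(** * Spectral extremal graphs *)

Section Extremal.
Local Open Scope ring_scope.
Variable R : realType.

(** The Rayleigh bound at the all-ones vector. *)
Lemma sum_degrees_le n (G : sgraph 'I_n) :
  (\sum_v #|nbhd G v|)%:R <= spectral_radius R G * n%:R.
Proof.
have := @spectral_rayleigh R n G (fun=> 1).
rewrite /quad expr1n sumr_const card_ord natr_sum.
congr (_ <= _); apply: eq_bigr => i _.
by rewrite mulr1 sumr_const.
Qed.

Lemma edges_le n (G : sgraph 'I_n) :
  (#|edges G| * 2)%:R <= spectral_radius R G * n%:R.
Proof. by rewrite -sum_nbhd; apply: sum_degrees_le. Qed.

Lemma bipartite_fan_free (V : finType) (H : sgraph V) (b : pred V) (k : nat) :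
  (0 < k)%N -> (forall u v, adj H u v -> b u != b v) -> graph_free (fan k) H.
Proof.
move=> k0 Hb; apply/negP => /contains_copyP [f _ fa].
have [u [v [au av uv]]] := fan_triangle None k0.
have := Hb _ _ (fa _ _ au); have := Hb _ _ (fa _ _ av).
have := Hb _ _ (fa _ _ uv).
by case: (b _); case: (b _); case: (b _).
Qed.

(** In the balanced complete bipartite graph all degrees are at least [n./2], hence so is their
    average. *)
Lemma exists_fan_free_large_radius n k : (0 < n)%N -> (0 < k)%N ->
  exists2 H : sgraph 'I_n, graph_free (fan k) H &
    (n./2)%:R <= spectral_radius R H.
Proof.
move=> n0 k0; pose r (i j : 'I_n) := (i < n./2)%N != (j < n./2)%N.
have rC i j : r i j || r j i = r i j by rewrite /r (eq_sym (j < _)%N) orbb.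
exists (rel_graph r).
  apply: (@bipartite_fan_free _ _ (fun i : 'I_n => i < n./2)%N) => // u v.
  by rewrite adj_rel_graph rC => /andP[].
have n0' : 0 < n%:R :> R by rewrite ltr0n.
rewrite -(ler_pM2r n0') -natrM; apply: le_trans (sum_degrees_le _).
rewrite ler_nat mulnC -[X in (X * _)%N]card_ord -sum_nat_const.
apply: leq_sum => i _.
have hn : (n./2 <= n)%N by lia.
have irr : {in [pred j | r i j], forall j, i != j}.
  by move=> j; rewrite inE /r; apply: contraNneq => ->.
have inN j : r i j -> j \in nbhd (rel_graph r) i.
  by move=> ij; rewrite in_nbhd adj_rel_graph rC ij irr.
pose w (j : 'I_(n./2)) : 'I_n := widen_ord hn j.
have wI : injective w by move=> j1 j2 /(congr1 val) /= /val_inj.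
have [ih|ih] := ltnP i n./2.
  rewrite -[X in (X <= _)%N](card_ord n./2).
  rewrite -(card_imset _ (inj_comp rev_ord_inj wI)).
  apply: subset_leq_card; apply/subsetP => _ /imsetP[j _ ->]; apply: inN.
  by rewrite /r ih /=; have := ltn_ord j; lia.
rewrite -[X in (X <= _)%N](card_ord n./2) -(card_imset _ wI).
apply: subset_leq_card; apply/subsetP => _ /imsetP[j _ ->]; apply: inN.
by rewrite /r ltnNge ih /= ltn_ord.
Qed.

Section Weights.
Variables (n : nat) (x : 'I_n -> R).
Hypothesis x01 : forall i, 0 <= x i <= 1.

Lemma sum_weights_le_card (A : {set 'I_n}) : \sum_(i in A) x i <= #|A|%:R.
Proof.
rewrite -sumr_const; apply: ler_sum => i _.
by case/andP: (x01 i).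
Qed.

Lemma sum_weights_sub (A B : {set 'I_n}) :
  A \subset B -> \sum_(i in A) x i <= \sum_(i in B) x i.
Proof.
move=> AB; rewrite [leRHS](big_setID A) /= (setIidPr AB) lerDl.
by apply: sumr_ge0 => i _; case/andP: (x01 i).
Qed.

Lemma sum_weights_setD (A B : {set 'I_n}) :
  \sum_(i in A) x i <= \sum_(i in A :\: B) x i + #|B|%:R.
Proof.
rewrite (big_setID B) /= addrC lerD2l.
apply: le_trans (sum_weights_le_card _) _.
by rewrite ler_nat subset_leq_card // subsetIr.
Qed.

End Weights.

(** The form at [|y|] dominates the absolute value of the form at [y], so no eigenvalue lies below
    minus the spectral radius. *)
Lemma quad_ge n (G : sgraph 'I_n) (y : 'I_n -> R) :
  - (spectral_radius R G * \sum_i y i ^+ 2) <= quad G y.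
Proof.
rewrite lerNl; apply: (@le_trans _ _ (quad G (fun i => `|y i|))).
  rewrite /quad -sumrN; apply: ler_sum => i _; rewrite -sumrN.
  by apply: ler_sum => j _; rewrite -normrM -normrN ler_norm.
apply: le_trans (spectral_rayleigh _ _) _.
by under eq_bigr do rewrite real_normK ?num_real //.
Qed.

(* [l - A] annihilates [x], so the quadratic forms of [l - A] at [m 1 - l x]
   and at [m 1] agree. *)
Lemma quad_perron_shift n (G : sgraph 'I_n) (x : 'I_n -> R) (m l : R) :
  (forall i, l * x i = \sum_(j in nbhd G i) x j) ->
  let y i := m - l * x i in
  l * (\sum_i y i ^+ 2) - quad G y =
  m ^+ 2 * (l * n%:R - (\sum_v #|nbhd G v|)%:R).
Proof.
move=> xE y.
have yE i : l * y i - \sum_(j in nbhd G i) y j = m * (l - #|nbhd G i|%:R).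
  rewrite /y sumrB sumr_const -mulr_sumr -xE -mulr_natr; ring.
(* Double counting: the degrees weighted by [x] have the same total as the neighbourhood sums of
   [x]. *)
have xd : \sum_i x i * #|nbhd G i|%:R = \sum_i l * x i.
  rewrite (eq_bigr (fun i => \sum_(j in nbhd G i) x i)); last first.
    by move=> i _; rewrite sumr_const mulr_natr.
  rewrite (exchange_big_dep xpredT) //=; apply: eq_bigr => i _.
  by rewrite xE; apply: eq_bigl => j; rewrite !in_nbhd adjC.
rewrite mulr_sumr /quad -sumrB.
rewrite (eq_bigr (fun i => m ^+ 2 * (l - #|nbhd G i|%:R) -
    (m * l) * (l * x i - x i * #|nbhd G i|%:R))); last first.
  move=> i _; rewrite -mulr_sumr expr2 mulrCA -mulrBr yE /y; ring.
rewrite sumrB -!mulr_sumr !sumrB xd subrr mulr0 subr0.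
by rewrite sumr_const card_ord natr_sum mulr_natr.
Qed.

(** Up to lower-order terms the left side is at most [n^2 / 4] and the right side at least
    [n^2 / 2]. *)
Lemma quadratic_gap (a b D n l m : R) :
  0 <= a -> 0 <= b -> 0 <= D -> 8 * (a + b + D + 1) <= n ->
  0 <= l <= n / 2 + a -> n / 2 - b <= m ->
  2 * l * (n / 4 + D) < 2 * m ^+ 2.
Proof.
move=> a0 b0 D0 nN /andP[l0 la] mb.
have h1 : l * (n / 4 + D) <= (n / 2 + a) * (n / 4 + D) by apply: ler_wpM2r; lra.
have h2 : (n / 2 - b) ^+ 2 <= m ^+ 2 by rewrite ler_sqr ?nnegrE; lra.
have h3 : n * (8 * (a + b + D + 1)) <= n * n by apply: ler_wpM2l; lra.
have h4 : D * a <= n * a by apply: ler_wpM2r; lra.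
have h5 : 0 <= n * D by apply: mulr_ge0; lra.
have h6 : 0 <= n * b by apply: mulr_ge0; lra.
by nra.
Qed.

(** * Lower bounds for the Perron entries of a spectral extremal graph *)

Section SpectralExtremal.
Variables (k n : nat) (G : sgraph 'I_n).
Hypotheses (k0 : (0 < k)%N) (free : graph_free (fan k) G).
Hypothesis Gmax : forall H : sgraph 'I_n, graph_free (fan k) H ->
  spectral_radius R H <= spectral_radius R G.
Let l := spectral_radius R G.
Hypothesis l0 : 0 < l.
Variable x : 'I_n -> R.
Hypotheses (x01 : forall i, 0 <= x i <= 1)
  (xE : forall i, l * x i = \sum_(j in nbhd G i) x j).

Let x0 i : 0 <= x i. Proof. by case/andP: (x01 i). Qed.

(** If [x z = 1], the neighbours of [z] weigh [l] in total. Attaching [v] to the independent part of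
    [N(z)] loses at most [2k] for the cover and 1 for [v] itself. *)
Lemma perron_entry_ge v : (exists z, x z = 1) -> l - (k * 2).+1%:R <= l * x v.
Proof.
move=> [z xz]; have [X Xk Xi] := fan_free_cover z free.
pose J := (nbhd G z :\: X) :\ v.
have vJ : v \notin J by rewrite !inE eqxx.
have Ji : independent G J.
  by move=> a b /setD1P[_ aJ] /setD1P[_ bJ]; apply: Xi.
have := reattach_sum_le l0 x0 xE vJ
  (Gmax (free_reattach_independent k0 free vJ Ji)).
have := xE z; rewrite xz mulr1 -/l => lE.
have := sum_weights_setD x01 (nbhd G z) X.
have := sum_weights_setD x01 (nbhd G z :\: X) [set v].
rewrite -lE -/J cards1 -natr1.
have : #|X|%:R <= (k * 2)%:R :> R by rewrite ler_nat.
lra.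
Qed.

(** [v] is attached to [T] without [v]; the omitted entry costs at most 1. *)
Lemma perron_entry_ge_sum (T : {set 'I_n}) v :
  (forall Q : {set 'I_n}, Q \subset T -> (#|Q| <= k * 2)%N ->
     ((k * 2).+1 < #|common_nbhd G Q|)%N) ->
  \sum_(i in T) x i - 1 <= l * x v.
Proof.
move=> Tc; have vJ : v \notin T :\ v by rewrite !inE eqxx.
have := reattach_sum_le l0 x0 xE vJ
  (Gmax (free_reattach_common free vJ _)).
have := sum_weights_setD x01 T [set v]; rewrite cards1 -/l => h1 h2.
suff : \sum_(j in T :\ v) x j <= l * x v by lra.
apply: h2 => Q QT; apply: Tc; apply: subset_trans QT _; exact: subsetDl.
Qed.

End SpectralExtremal.

(** Edge counts enter doubled, so a slack below 2 leaves no room for one more edge. *)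
Lemma spectral_extremal_edges k : (0 < k)%N ->
  exists N : nat, forall n : nat, (N <= n)%N -> forall G : sgraph 'I_n,
    graph_free (fan k) G ->
    (forall H : sgraph 'I_n, graph_free (fan k) H ->
       spectral_radius R H <= spectral_radius R G) ->
    spectral_radius R G * n%:R < (#|edges G| * 2)%:R + 2.
Proof.
(* Degrees will be at least [l - (2k + 1)] with [l >= n/2 - 1/2], so twice a degree is at least
   [n - (4k + 3)]. *)
move=> k0; pose c := (k * 4 + 3)%N; have [N [C str]] := fan_free_structure k c.
(* [D] allows a squared deviation of [(e + 1)^2] at each of at most [C] exceptional vertices; [N']
   is the threshold in [quadratic_gap]. *)
pose e := ((k * 2).+1)%N; pose D := (C * e.+1 ^ 2)%N.
pose N' := (8 * (c + k * 4 + e.+1 + D + 1))%N.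
exists (N + N' + C).+1 => n nN G free Gmax.
have n0 : (0 < n)%N by lia.
have [H0 H0free H0l] := exists_fan_free_large_radius n0 k0.
have lh := le_trans H0l (Gmax _ H0free).
set l := spectral_radius R G in lh *.
have {H0 H0free H0l} ln : n%:R / 2 - 1 / 2 <= l.
  apply: le_trans lh; have : (n <= n./2 * 2 + 1)%N by lia.
  by rewrite -(ler_nat R) natrD natrM; lra.
have l0 : 0 < l by apply: lt_le_trans lh; rewrite ltr0n; lia.
have [x [x01 x1 xE]] := perron R G n0; rewrite -/l in xE.
have xge v := perron_entry_ge k0 free Gmax l0 x01 xE v x1; rewrite -/l -/e in xge.
have deg v : (#|'I_n| <= #|nbhd G v| * 2 + c)%N.
  have := sum_weights_le_card x01 (nbhd G v); rewrite -xE => dv.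
  have := xge v; rewrite card_ord -(ler_nat R) natrD natrM /c /e -natr1 natrD !natrM.
  lra.
have [|S [T [U [cU Utyp Sc Tc]]]] := str _ G free deg; first by rewrite card_ord; lia.
have Sge v := perron_entry_ge_sum free Gmax l0 x01 xE v Sc.
have Tge v := perron_entry_ge_sum free Gmax l0 x01 xE v Tc.
rewrite -/l in Sge Tge.
set s := \sum_(i in S) x i in Sge; set t := \sum_(i in T) x i in Tge.
pose M := Num.max s t.
have Mge v : M - 1 <= l * x v by rewrite /M; case: (leP s t).
have Mle v : v \notin U -> l * x v <= M.
  move=> /Utyp vU; rewrite xE /M le_max.
  by case: vU => h; apply/orP; [left|right]; apply: sum_weights_sub.
have [u uU] : exists u, u \notin U.
  have : (0 < #|~: U|)%N by have := cardsC U; rewrite card_ord; lia.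
  by case/card_gt0P => u; rewrite inE; exists u.
have lM : l - e%:R <= M := le_trans (xge u) (Mle u uU).
have lle : l <= n%:R / 2 + (c + k * 4)%:R.
  have [z xz] := x1; have := xE z; rewrite xz mulr1 => ->.
  apply: le_trans (sum_weights_le_card x01 _) _.
  have : (#|nbhd G z| * 2 <= #|'I_n| + (c + k * 4))%N.
    by apply: max_degree free deg _; rewrite card_ord; lia.
  rewrite card_ord -(ler_nat R) natrM natrD.
  have : 0 <= (c + k * 4)%:R :> R by apply: ler0n.
  lra.
have xle v : l * x v <= l by rewrite ger_pMr //; case/andP: (x01 v).
(* [m] is the midpoint of [[M - 1, M]], so [|y v| <= 1/2] outside [U]; inside,
   [M - 1 <= l x_v <= l <= M + e] gives [|y v| <= e + 1]. *)
pose m := M - 1 / 2; pose y i := m - l * x i.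
have y2 v : y v ^+ 2 <= 1 / 4 + (if v \in U then e.+1%:R ^+ 2 else 0).
  have sq (a b : R) : 0 <= b - a -> 0 <= b + a -> a ^+ 2 <= b ^+ 2 by nra.
  have := Mge v; have := Mle v; have := xle v.
  rewrite -[e.+1%:R]natr1.
  have e0 : 0 <= e%:R :> R by apply: ler0n.
  case: (boolP (v \in U)) => vU h1 h2 h3.
    apply: le_trans (sq _ (e%:R + 1) _ _) _; rewrite /y /m; lra.
  by have := h2 isT => {}h2; have := sq (y v) (1 / 2); rewrite /y /m; lra.
have Sy : \sum_i y i ^+ 2 <= n%:R / 4 + D%:R.
  apply: le_trans (ler_sum _ (fun i _ => y2 i)) _.
  rewrite big_split /= sumr_const card_ord -big_mkcond sumr_const /=.
  rewrite -[_ *+ n]mulr_natr -[_ *+ #|_|]mulr_natr /D natrM natrX.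
  apply: lerD; first by rewrite mul1r mulrC.
  by rewrite mulrC ler_wpM2r ?sqr_ge0 // ler_nat.
have := quad_perron_shift m xE; have := quad_ge G y; rewrite -/l /= -/y sum_nbhd.
have gap : 2 * l * (n%:R / 4 + D%:R) < 2 * m ^+ 2.
  apply: (@quadratic_gap (c + k * 4)%:R e.+1%:R); rewrite ?ler0n ?(ltW l0) ?lle //.
    have : (N' <= n)%N by lia.
    by rewrite -(ler_nat R) natrM (natrD _ _ 1) (natrD _ _ D) (natrD _ _ e.+1).
  by rewrite /m -[e.+1%:R]natr1; lra.
have : 2 * l * \sum_i y i ^+ 2 <= 2 * l * (n%:R / 4 + D%:R).
  by rewrite ler_pM2l //; lra.
move: (\sum_i _) (quad _ _) gap => w q gap wD qw E.
(* The left side equals [l |y|^2] minus the form at [y], so it is at most [2 l |y|^2], which [gap]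
   puts below [2 m^2]. *)
have : m ^+ 2 * (l * n%:R - (#|edges G| * 2)%:R) < m ^+ 2 * 2 by lra.
have m2 : 0 < m ^+ 2.
  have : 0 <= 2 * l * (n%:R / 4 + D%:R).
    by apply: mulr_ge0; rewrite ?addr_ge0 ?divr_ge0 ?ler0n //; lra.
  lra.
by rewrite ltr_pM2l //; lra.
Qed.

End Extremal.

Theorem theorem1p2 (R : realType) (k : nat) (hk : (1 <= k)%N) :
  exists N : nat, forall n : nat, (N <= n)%N ->
  forall G : sgraph 'I_n,
    graph_free (fan k) G ->
    (forall H : sgraph 'I_n, graph_free (fan k) H ->
       (spectral_radius R H <= spectral_radius R G)%R) ->
    G \in extremal_graphs n (fan k).
Proof.
have [N HN] := spectral_extremal_edges R hk; exists N => n nN G free Gmax.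
have lG := HN n nN G free Gmax.
rewrite inE free /= eqn_leq; apply/andP; split.
  by rewrite /turan_number; apply: (@leq_bigmax_cond _ _ (fun H => #|edges H|)).
apply/bigmax_leqP => H Hfree.
rewrite -ltnS -(@ltn_pmul2r 2) // mulSn addnC -(ltr_nat R) natrD.
apply: le_lt_trans lG.
apply: le_trans (edges_le R H) _.
by apply: ler_wpM2r; [exact: ler0n | exact: Gmax].
Qed.
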